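(* Let $H, K$ be Hilbert spaces, let $T$ be a closed linear relation from $H$ into $K$ and let $S$ be a linear relation from $H$ into $K$ such that $M(S)\subset M(T)$ and $D(T)\subset D(S)$, and such that, for some real number $b$ with $0<b<1$, $\|Sx\|\le b\,\|Tx\|$ for all $x\in D(T)$. If $T$ is Hyers-Ulam stable, then $S+T$ is also Hyers-Ulam stable.
   Context: $H, K$ are real or complex Hilbert spaces (over the same field). A linear relation $T$ from $H$ into $K$ is a linear subspace of $H\times K$ (elements written $\{h,k\}$); it is closed if it is a closed subspace. $D(T)=\{h\in H: \{h,k\}\in T \text{ for some } k\}$, $R(T)=\{k\in K:\{h,k\}\in T \text{ for some } h\}$, $M(T)=\{k\in K:\{0,k\}\in T\}$ (multi-valued part). The sum is $T+S=\{\{x,y+z\}: \{x,y\}\in T,\ \{x,z\}\in S\}$. For a linear relation $T$ from $H$ into $K$, $Q_T: K\to K/\overline{M(T)}$ is the natural quotient map; $Q_TT$ is a (single-valued) linear operator with domain $D(T)$, and $\|Tx\|:=\|Q_TTx\|$ for $x\in D(T)$, i.e. $\|Tx\|=\operatorname{dist}(y,M(T))$ for any $y$ with $\{x,y\}\in T$. A linear relation $T$ between normed linear spaces is Hyers-Ulam stable if there is a constant $M\ge 0$ such that for any $y\in R(T)$, $\varepsilon\ge 0$ and $y_0\in R(T)$ with $\|y-y_0\|\le\varepsilon$, there exist $\{x,y\}\in T$ and $\{x_0,y_0\}\in T$ such that $\|x-x_0\|\le M\varepsilon$. *)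

(* Defs.v *)
From HB Require Import structures.
From mathcomp Require Import all_boot all_order all_algebra sesquilinear.
From mathcomp Require Import complex.
From mathcomp Require Import all_classical all_reals topology normedtype.

Set Implicit Arguments.
Unset Strict Implicit.
Unset Printing Implicit Defensive.

Import Order.TTheory GRing.Theory Num.Theory.
Import numFieldNormedType.Exports.
Local Open Scope classical_set_scope.
Local Open Scope ring_scope.

Variant scalar_kind := RealScalars | ComplexScalars.

Definition scalarField (R : realType) (k : scalar_kind) : numFieldType :=
  match k with
  | RealScalars => R
  | ComplexScalars => R[i]
  end.

Definition scalar_conj (R : realType) (k : scalar_kind) :
    scalarField R k -> scalarField R k :=
  match k with
  | RealScalars => idfun
  | ComplexScalars => @conjc R
  end.

Definition scalar_Re (R : realType) (k : scalar_kind) : scalarField R k -> R :=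
  match k with
  | RealScalars => idfun
  | ComplexScalars => @complex.Re R
  end.

(* [inner] is linear in its first argument, conjugate-linear in its second one,
   and positive definite. *)
HB.mixin Record isHilbert (R : realType) (k : scalar_kind) H
    of CompleteNormedModule (scalarField R k) H := {
  inner : {dot H for @scalar_conj R k} ;
  inner_norm : forall x : H, inner x x = `|x| ^+ 2 }.

#[short(type="hilbertType")]
HB.structure Definition Hilbert (R : realType) (k : scalar_kind) :=
  {H of CompleteNormedModule (scalarField R k) H & isHilbert R k H}.

Section LinearRelations.
Context {R : realType} {k : scalar_kind}.

(* The library norm takes its values in the scalar field; this is the same
   norm with values in [R], where infima exist. *)
Definition rnorm (V : normedModType (scalarField R k)) (v : V) : R :=
  scalar_Re `|v|.

Context {H K : normedModType (scalarField R k)}.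
Implicit Types T S : set (H * K).

Definition linear_relation T := submod_closed (mem T).

Definition rel_dom T : set H := [set h | exists y, T (h, y)].

Definition rel_range T : set K := [set y | exists h, T (h, y)].

Definition rel_mvpart T : set K := [set y | T (0, y)].

Definition rel_add T S : set (H * K) :=
  [set p | exists y z, [/\ T (p.1, y), S (p.1, z) & p.2 = y + z]].

(* The elements of the quotient space [K / closure (rel_mvpart T)] are represented
   by the cosets, as subsets of [K]. *)
Definition quotient_map T (y : K) : set K :=
  [set z | closure (rel_mvpart T) (z - y)].

Definition quotient_norm (C : set K) : R := inf [set rnorm z | z in C].

(* For [x] in [rel_dom T] and a linear relation [T], the coset below does not
   depend on the chosen [y] with [T (x, y)]. *)
Definition quotient_op T (x : H) : set K :=
  quotient_map T (xget 0 [set y | T (x, y)]).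

Definition rel_norm T (x : H) : R := quotient_norm (quotient_op T x).

Definition hyers_ulam_stable T :=
  exists2 M : R, 0 <= M &
    forall (y : K) (e : R) (y0 : K),
      rel_range T y -> 0 <= e -> rel_range T y0 -> rnorm (y - y0) <= e ->
    exists x x0 : H, [/\ T (x, y), T (x0, y0) & rnorm (x - x0) <= M * e].

End LinearRelations.

(* Main.v *)
(* A linear relation is stable iff every y in its range has a preimage of norm
   at most M |y|. Let {x, s} in S, {x, t} in T and w = s + t. From
   |Sx| <= b |Tx| one gets (1 - b) |Tx| <= |w|, so t may be changed by an
   element of M(T) into some t' with |t'| <= 2 |w| / (1 - b), and stability of T
   gives {x', t'} in T with |x'| <= M |t'|. The difference x - x' lies in the
   kernel of T; there Sx has norm zero, so S maps it into the closed subspace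
   M(T), and hence {x', w} still belongs to S + T. *)

Require Import Defs.
From HB Require Import structures.
From mathcomp Require Import all_boot all_order all_algebra sesquilinear.
From mathcomp Require Import complex lra.
From mathcomp Require Import all_classical all_reals topology normedtype.

Set Implicit Arguments.
Unset Strict Implicit.
Unset Printing Implicit Defensive.

Import Order.TTheory GRing.Theory Num.Theory.
Import numFieldNormedType.Exports.
Local Open Scope classical_set_scope.
Local Open Scope ring_scope.

Lemma scalar_Re_le (R : realType) (k : scalar_kind) (x y : scalarField R k) :
  x <= y -> scalar_Re x <= scalar_Re y.
Proof. by case: k x y => //= -[a b] [c d]; rewrite lecE => /andP[]. Qed.

Lemma scalar_ReD (R : realType) (k : scalar_kind) (x y : scalarField R k) :
  scalar_Re (x + y) = scalar_Re x + scalar_Re y.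
Proof. by case: k x y => //= -[a b] [c d]. Qed.

Lemma scalar_Re0 (R : realType) (k : scalar_kind) :
  scalar_Re (0 : scalarField R k) = 0.
Proof. by case: k. Qed.

(** In the order on complex scalars, being nonnegative forces the imaginary part to vanish, so only
    real parts are compared. *)
Lemma scalar_Re_ltE (R : realType) (k : scalar_kind) (x y : scalarField R k) :
  0 <= x -> 0 <= y -> (x < y) = (scalar_Re x < scalar_Re y).
Proof.
case: k x y => //= -[a b] [c d]; rewrite !lecE ltcE /=.
by move=> /andP[/eqP-> _] /andP[/eqP-> _]; rewrite eqxx.
Qed.

Lemma scalar_Re_surj (R : realType) (k : scalar_kind) (e : R) : 0 < e ->
  exists2 x : scalarField R k, 0 < x & scalar_Re x = e.
Proof.
case: k => e0; first by exists e.
by exists (e%:C)%C; rewrite //= ltcR.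
Qed.

Section RealNorm.
Context {R : realType} {k : scalar_kind} {V : normedModType (scalarField R k)}.
Implicit Types (u v : V) (A : set V).

Lemma rnorm_ge0 v : 0 <= rnorm v.
Proof. by rewrite -(scalar_Re0 R k) scalar_Re_le. Qed.

Lemma rnorm0 : rnorm (0 : V) = 0.
Proof. by rewrite /rnorm normr0 scalar_Re0. Qed.

Lemma rnorm_gt0 v : v != 0 -> 0 < rnorm v.
Proof. by rewrite -(scalar_Re0 R k) -scalar_Re_ltE// normr_gt0. Qed.

Lemma ler_rnormD u v : rnorm (u + v) <= rnorm u + rnorm v.
Proof. by rewrite -scalar_ReD scalar_Re_le// ler_normD. Qed.

Lemma ler_rnormB u v : rnorm (u - v) <= rnorm u + rnorm v.
Proof. by rewrite (le_trans (ler_rnormD _ _))// /rnorm normrN. Qed.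

(** Passes from balls with radii in the scalar field to real radii, the form in which infima of
    [rnorm] can be used. *)
Lemma closure_rnormP A v :
  closure A v <-> forall e : R, 0 < e -> exists2 a, A a & rnorm (v - a) < e.
Proof.
split=> [clA e /(scalar_Re_surj k)[x x0 <-]|clA B /nbhs_ballP[x /= x0 xB]].
  have [a [Aa]] := clA _ (nbhsx_ballx v x x0).
  rewrite -ball_normE /= scalar_Re_ltE ?(ltW x0)// => va.
  by exists a.
have Rx0 : 0 < scalar_Re x.
  by rewrite -(scalar_Re0 R k) -scalar_Re_ltE// ltW.
have [a Aa va] := clA _ Rx0.
exists a; split=> //; apply: xB.
by rewrite -ball_normE /= scalar_Re_ltE// ltW.
Qed.

End RealNorm.

Section LinearRelationTheory.
Context {R : realType} {k : scalar_kind} {H K : normedModType (scalarField R k)}.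
Implicit Types (T S : set (H * K)) (x : H) (y z : K).

Lemma linear_relation0 T : linear_relation T -> T (0, 0).
Proof. by case=> + _; rewrite inE. Qed.

Lemma linear_relationZD T a x y x' y' : linear_relation T ->
  T (x, y) -> T (x', y') -> T (a *: x + x', a *: y + y').
Proof.
case=> _ linT Txy Txy'.
by have := linT a (x, y) (x', y'); rewrite !inE; apply.
Qed.

Lemma linear_relationD T x y x' y' : linear_relation T ->
  T (x, y) -> T (x', y') -> T (x + x', y + y').
Proof.
by move=> linT Txy /(linear_relationZD 1 linT Txy); rewrite !scale1r.
Qed.

Lemma linear_relationB T x y x' y' : linear_relation T ->
  T (x, y) -> T (x', y') -> T (x - x', y - y').
Proof.
move=> linT Txy Txy'; have := linear_relationZD (-1) linT Txy' Txy.
by rewrite !scaleN1r ![- _ + _]addrC.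
Qed.

Lemma linear_relation_add T S :
  linear_relation T -> linear_relation S -> linear_relation (rel_add T S).
Proof.
move=> linT linS; split.
  rewrite inE; exists 0, 0; rewrite addr0.
  by split=> //; exact: linear_relation0.
move=> a [x1 y1] [x2 y2]; rewrite !inE => -[t1 [s1 /= [Tt1 Ss1 ->]]].
move=> [t2 [s2 /= [Tt2 Ss2 ->]]]; exists (a *: t1 + t2), (a *: s1 + s2).
split=> /=; [exact: linear_relationZD|exact: linear_relationZD|].
by rewrite scalerDr addrACA.
Qed.

Lemma rel_mvpartN T y : linear_relation T ->
  rel_mvpart T y -> rel_mvpart T (- y).
Proof.
move=> linT Ty; have := linear_relationB linT (linear_relation0 linT) Ty.
by rewrite !sub0r oppr0.
Qed.

Lemma closed_rel_mvpart T : closed T -> closed (rel_mvpart T).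
Proof.
move=> clT; have ct : continuous (fun y : K => (0 : H, y)).
  by move=> y; apply: cvg_pair; [exact: cvg_cst|exact: cvg_id].
exact: (preimage_closed (fun y _ => ct y) clT).
Qed.

(** Two values of [T] at [x] differ by an element of the multivalued part, so the choice made by
    [xget] does not matter. *)
Lemma quotient_opE T x y : linear_relation T -> T (x, y) ->
  quotient_op T x = quotient_map T y.
Proof.
move=> linT Txy; rewrite /quotient_op.
case: xgetP => [y' _ /= Txy'|/(_ y)//].
have shift z1 z2 z : T (x, z1) -> T (x, z2) ->
    quotient_map T z1 z -> quotient_map T z2 z.
  move=> Tz1 Tz2 /closure_rnormP clz; apply/closure_rnormP => e /clz[a Ta lta].
  (* Since [z - z2 = (z - z1) + (z1 - z2)], an approximant of [z - z1] is shifted by [z1 - z2]. *)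
  exists (a + (z1 - z2)).
    rewrite /rel_mvpart/= -(addr0 0); apply: linear_relationD => //.
    by rewrite -(subrr x); exact: linear_relationB.
  by rewrite opprD opprB addrCA addrC !addrA subrK addrAC in lta *.
by apply/seteqP; split=> z; exact: shift.
Qed.

Lemma has_lbound_rnorm (C : set K) : has_lbound [set rnorm z | z in C].
Proof. by exists 0 => _ [z _ <-]; exact: rnorm_ge0. Qed.

Lemma rel_norm_le T x y : linear_relation T -> T (x, y) ->
  rel_norm T x <= rnorm y.
Proof.
move=> linT Txy; rewrite /rel_norm (quotient_opE linT Txy).
apply: ge_inf; first exact: has_lbound_rnorm.
exists y => //; rewrite /quotient_map/= subrr; apply: subset_closure.
exact: linear_relation0.
Qed.

(** One half of [e] pays for nearly attaining the infimum over the coset, the other for replacing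
    the closure of the multivalued part by that part itself. *)
Lemma rel_norm_approx T x y e : linear_relation T -> T (x, y) -> 0 < e ->
  exists2 m, rel_mvpart T m & rnorm (y + m) < rel_norm T x + e.
Proof.
move=> linT Txy e0; rewrite /rel_norm (quotient_opE linT Txy).
have e20 : 0 < e / 2 by rewrite divr_gt0.
have /inf_adherent : has_inf [set rnorm z | z in quotient_map T y].
  split; last exact: has_lbound_rnorm.
  exists (rnorm y); exists y => //; rewrite /quotient_map/= subrr.
  by apply: subset_closure; exact: linear_relation0.
move=> /(_ _ e20)[_ [z /closure_rnormP/(_ _ e20)[m Tm zm] <-] ltz].
exists m => //; rewrite /quotient_norm.
have := ler_rnormB z (z - y - m).
by rewrite -[in X in X <= _]addrA -opprD subKr; lra.
Qed.

(** By linearity only the difference [y - y0] matters: one direction takes [y0 = 0] and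
    [e = rnorm y], the other translates by any preimage of [y0]. *)
Lemma hyers_ulam_stableP T : linear_relation T ->
  hyers_ulam_stable T <->
  exists2 M : R, 0 <= M & forall y, rel_range T y ->
    exists2 x, T (x, y) & rnorm x <= M * rnorm y.
Proof.
move=> linT; split=> -[M M0 huT]; exists M => //.
  move=> y Ty; have T00 := linear_relation0 linT.
  have [||x [x0 [Tx Tx0 le]]] := huT y (rnorm y) 0 Ty (rnorm_ge0 y).
  - by exists 0.
  - by rewrite subr0.
  by exists (x - x0) => //; rewrite -[y]subr0; exact: linear_relationB.
move=> y e y0 [x1 Ty] e0 [x0 Ty0] le.
have [|x Tx lex] := huT (y - y0).
  by exists (x1 - x0); exact: linear_relationB.
exists (x + x0), x0; split=> //.
  by rewrite -(subrK y0 y); exact: linear_relationD.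
by rewrite addrK (le_trans lex)// ler_wpM2l.
Qed.

Section Perturbation.
Variables (T S : set (H * K)) (b : R).
Hypotheses (linT : linear_relation T) (linS : linear_relation S).
Hypothesis mvST : rel_mvpart S `<=` rel_mvpart T.
Hypotheses (b_ge0 : 0 <= b) (b_lt1 : b < 1).
Hypothesis leST : forall x, rel_dom T x -> rel_norm S x <= b * rel_norm T x.

(* The factor 2 pays for the infima not being attained. *)
Lemma perturbation_lower_bound x s t : S (x, s) -> T (x, t) -> s + t != 0 ->
  exists2 m, rel_mvpart T m & rnorm (t + m) <= 2 / (1 - b) * rnorm (s + t).
Proof.
move=> Ss Tt /rnorm_gt0 w0.
(* The slack is the norm of [s + t] itself, which is why [s + t] has to be nonzero. *)
have [m Sm ltm] := rel_norm_approx linS Ss w0.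
have TNm := rel_mvpartN linT (mvST Sm).
exists (- m) => //.
have Ttm : T (x, t - m).
  by rewrite -[x]addr0; exact: linear_relationD.
have leT := rel_norm_le linT Ttm.
have leS : rel_norm S x <= b * rel_norm T x by apply: leST; exists t.
(* As [t - m = (s + t) - (s + m)], its norm is at most [2 * rnorm (s + t) + b * rnorm (t - m)]; the
   last term is absorbed on the left because [b < 1]. *)
have := ler_rnormB (s + t) (s + m).
rewrite opprD addrACA subrr add0r => tri.
rewrite mulrAC ler_pdivlMr ?subr_gt0//.
have := ler_wpM2l b_ge0 leT.
lra.
Qed.

Hypothesis clT : closed T.

(** The bound makes [rel_norm S x] vanish, so [s] is a limit of elements of [rel_mvpart S], hence of
    the closed set [rel_mvpart T]. *)
Lemma perturbation_kernel x s : S (x, s) -> T (x, 0) -> rel_mvpart T s.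
Proof.
move=> Ss T0.
have S0 : rel_norm S x <= 0.
  rewrite (le_trans (leST _))//; first by exists 0.
  by rewrite mulr_ge0_le0// (le_trans (rel_norm_le linT T0))// rnorm0.
rewrite (closure_id (rel_mvpart T)).1; last exact: closed_rel_mvpart.
apply/closure_rnormP => e e0.
have [m Sm ltm] := rel_norm_approx linS Ss e0.
exists (- m); last by rewrite opprK (lt_le_trans ltm)// gerDr.
exact: rel_mvpartN linT (mvST Sm).
Qed.

End Perturbation.

End LinearRelationTheory.

Theorem theorem3p18 (R : realType) (k : scalar_kind) (H K : hilbertType R k)
    (T S : set (H * K)) (b : R)
    (linT : linear_relation T) (clT : closed T) (linS : linear_relation S)
    (mvST : rel_mvpart S `<=` rel_mvpart T) (domTS : rel_dom T `<=` rel_dom S)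
    (b_gt0 : 0 < b) (b_lt1 : b < 1)
    (leST : forall x : H, rel_dom T x -> rel_norm S x <= b * rel_norm T x)
    (huT : hyers_ulam_stable T) :
  hyers_ulam_stable (rel_add S T).
Proof.
have linST := linear_relation_add linS linT.
have [M M0 {}huT] := (hyers_ulam_stableP linT).1 huT.
have c0 : 0 <= 2 / (1 - b) by rewrite divr_ge0// subr_ge0 ltW.
apply/(hyers_ulam_stableP linST); exists (M * (2 / (1 - b))).
  exact: mulr_ge0.
move=> w [x [s [t /= [Ss Tt ->]]]].
(* A zero value leaves no slack for the lower bound, but has the preimage 0. *)
have [st0|st0] := eqVneq (s + t) 0.
  exists 0; last by rewrite st0 !rnorm0 mulr0.
  by rewrite st0; exact: linear_relation0.
have [m Tm lem] :=
  perturbation_lower_bound linT linS mvST (ltW b_gt0) b_lt1 leST Ss Tt st0.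
have Ttm : T (x, t + m) by rewrite -[x]addr0; exact: linear_relationD.
have [|x' Tx' lex'] := huT (t + m); first by exists x.
exists x'; last by rewrite (le_trans lex')// -mulrA ler_wpM2l.
have Tker : T (x - x', 0) by rewrite -(subrr (t + m)); exact: linear_relationB.
have [s' Ss'] : rel_dom S (x - x') by apply: domTS; exists 0.
have Ts' := perturbation_kernel linT linS mvST (ltW b_gt0) leST clT Ss' Tker.
(* Moving [s'] from the [S] part to the [T] part keeps the sum. It is allowed at [x'] because
   [x' = x - (x - x')], and because [t + s'] differs from [t + m] by an element of
   [rel_mvpart T]. *)
exists (s - s'), (t + s'); split=> /=.
- by rewrite -(subKr x x'); exact: linear_relationB.
- have -> : t + s' = (t + m - m) + s' by rewrite addrK.
  rewrite -[x']addr0; apply: linear_relationD => //.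
  by rewrite -[x']subr0; exact: linear_relationB.
- by rewrite addrACA addNr addr0.
Qed.
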